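(* Let $(k_n)_{n\ge1}$ be a sequence of integers and let $\sigma_1>0$. Then there exists a sequence $(\sigma_n)_{n\ge1}$ of positive real numbers with the given first term $\sigma_1$ such that $$\rho_{\mathbb{D}}(2^{-\sigma_n},2^{-\sigma_k})\geq 1-\frac{1}{(nk)^4}\qquad\text{for all } n>k\ge1,$$ and for any such sequence $(\sigma_n)_n$, the sequence $(s_n)_n$ defined by $s_n:=\sigma_n+i\frac{2\pi k_n}{\log 2}$ is interpolating for $\mathscr{H}^{\infty}$.
   Context: For $z,w$ in the open unit disc $\mathbb{D}$, $\rho_{\mathbb{D}}(z,w)=\left|\frac{z-w}{1-\overline{z}w}\right|$. $\mathbb{C}_+=\{s\in\mathbb{C}:\operatorname{Re}(s)>0\}$. $\mathscr{H}^\infty$ is the algebra of all bounded analytic functions $f$ on $\mathbb{C}_+$ that can be represented by a Dirichlet series $f(s)=\sum_{n\ge1}a_n n^{-s}$ (convergent in some half-plane). A sequence $(s_n)_n$ in $\mathbb{C}_+$ is interpolating for $\mathscr{H}^\infty$ if for every bounded complex sequence $(\alpha_n)_n$ there is $f\in\mathscr{H}^\infty$ with $f(s_n)=\alpha_n$ for every $n$. *)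

(* Defs.v *)
From Stdlib Require Import Reals ZArith.
From Coquelicot Require Import Coquelicot.

Open Scope R_scope.

(** Pseudohyperbolic distance; meaningful for [z], [w] in the open unit disc. *)
Definition rho_D (z w : C) : R :=
  Cmod ((z - w) / (RtoC 1 - Cconj z * w))%C.

(** Coquelicot has no complex exponential: e^(x + iy) = e^x (cos y + i sin y). *)
Definition Cexp (s : C) : C :=
  (exp (Re s) * cos (Im s), exp (Re s) * sin (Im s)).

(** n^(-s) = e^(-s log n), for n >= 1. *)
Definition npow_neg (n : nat) (s : C) : C :=
  Cexp (- s * RtoC (ln (INR n)))%C.

(** Values of [f] outside C_+ = {Re s > 0} are irrelevant.  Analytic on C_+
    means complex differentiable at each of its points. *)
Definition analytic_on_Cplus (f : C -> C) : Prop :=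
  forall s : C, 0 < Re s -> @ex_derive C_AbsRing C_NormedModule f s.

Definition bounded_on_Cplus (f : C -> C) : Prop :=
  exists M : R, forall s : C, 0 < Re s -> Cmod (f s) <= M.

(** The series starts at n = 1, while [is_series] sums from index 0.  The
    half-plane of convergence may be strictly smaller than C_+. *)
Definition has_Dirichlet_series (f : C -> C) : Prop :=
  exists (a : nat -> C) (x0 : R), forall s : C, 0 < Re s -> x0 < Re s ->
    @is_series C_AbsRing C_NormedModule
      (fun n : nat => (a (S n) * npow_neg (S n) s)%C) (f s).

Definition in_Hinfty (f : C -> C) : Prop :=
  analytic_on_Cplus f /\ bounded_on_Cplus f /\ has_Dirichlet_series f.

(** Sequences indexed by n >= 1 are functions on [nat] whose value at 0 is
    ignored. *)
Definition interpolating_Hinfty (s : nat -> C) : Prop :=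
  (forall n : nat, (1 <= n)%nat -> 0 < Re (s n)) /\
  forall alpha : nat -> C,
    (exists M : R, forall n : nat, (1 <= n)%nat -> Cmod (alpha n) <= M) ->
    exists f : C -> C,
      in_Hinfty f /\ forall n : nat, (1 <= n)%nat -> f (s n) = alpha n.

(** Positive sequences (sigma_n)_{n >= 1} with first term [sigma1] whose points
    2^(-sigma_n) are separated as prescribed. *)
Definition admissible (sigma1 : R) (sigma : nat -> R) : Prop :=
  sigma 1%nat = sigma1 /\
  (forall n : nat, (1 <= n)%nat -> 0 < sigma n) /\
  (forall n k : nat, (1 <= k)%nat -> (k < n)%nat ->
     rho_D (RtoC (Rpower 2 (- sigma n))) (RtoC (Rpower 2 (- sigma k)))
       >= 1 - 1 / (INR n * INR k) ^ 4).

(* Main.v *)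
Require Import Defs.
From Stdlib Require Import Reals ZArith Lra Lia.
From Coquelicot Require Import Coquelicot.
Open Scope R_scope.

(** All the points [s_n] are sent by [s |-> 2^(-s)] to real points [x_n] of the
    unit disc, so it suffices to interpolate at the [x_n] by a bounded analytic
    [g] on the disc and to put [f s = g (2^(-s))]; the Taylor series of [g] at 0
    is then the Dirichlet series of [f].

    Instead of Blaschke products we use [h_j = 1 - phi_j^2], where
    [phi_j(z) = (z - x_j) / (1 - x_j z)].  Then [h_j(x_n) = 1 - rho(x_j, x_n)^2],
    so that [h_j(x_j) = 1], while off the diagonal the matrix [h_j(x_n)] is so
    small that it is a perturbation of norm less than 1 of the identity on bounded
    sequences.  A Neumann series thus gives a bounded [c] for which
    [g = sum_j c_j h_j] interpolates.  The sum of the [|h_j|] is bounded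
    on the disc because [|h_j(z)|] is at most a constant times
    [m_j = d_j t / (d_j + t)^2], with [d_j = 1 - x_j] and [t = |1 - z|], and
    [m_j m_n <= h_j(x_n)]: all the [m_j] but one are small. *)

(** * Moduli and absolutely convergent series of complex numbers *)

Lemma Cmod_le_Re_Im (z : C) : Cmod z <= Rabs (Re z) + Rabs (Im z).
Proof.
  destruct z as [a b]; simpl.
  replace (a, b) with ((RtoC a) + Ci * (RtoC b))%C
    by (apply injective_projections; simpl; ring).
  eapply Rle_trans; [apply Cmod_triangle|].
  rewrite Cmod_mult, Cmod_Ci, !Cmod_R; lra.
Qed.

Lemma im_le_Cmod (z : C) : Rabs (Im z) <= Cmod z.
Proof.
  eapply Rle_trans; [|apply Rmax_Cmod]; apply Rmax_r.
Qed.

Lemma Cmod_sub_ge (x y : C) : Cmod x - Cmod y <= Cmod (x - y).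
Proof.
  assert (H := Cmod_triangle (x - y) y).
  replace (x - y + y)%C with x in H by ring; lra.
Qed.

Lemma Cmod_sub_le (x y : C) : Cmod (x - y) <= Cmod x + Cmod y.
Proof.
  assert (H := Cmod_triangle x (- y)); rewrite Cmod_opp in H; exact H.
Qed.

(** Componentwise summation reduces everything to the real [Series]. As [Series] is total, the value
    is only meaningful for convergent series, which [Csummable] guarantees. *)
Definition CSeries (u : nat -> C) : C :=
  (Series (fun n => Re (u n)), Series (fun n => Im (u n))).

Definition Csummable (u : nat -> C) : Prop := ex_series (fun n => Cmod (u n)).

Lemma Csummable_le (u : nat -> C) (v : nat -> R) :
  (forall n, Cmod (u n) <= v n) -> ex_series v -> Csummable u.
Proof.
  intros H Hv; unfold Csummable.
  apply (ex_series_le (K := R_AbsRing) (V := R_CompleteNormedModule) _ v); auto.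
  intros n; unfold norm; simpl; unfold abs; simpl.
  rewrite Rabs_pos_eq; auto using Cmod_ge_0.
Qed.

Lemma ex_series_Rabs_le (u v : nat -> R) :
  (forall n, Rabs (u n) <= v n) -> ex_series v -> ex_series u.
Proof.
  intros H Hv.
  apply (ex_series_le (K := R_AbsRing) (V := R_CompleteNormedModule) _ v); auto.
Qed.

Lemma Csummable_Re (u : nat -> C) : Csummable u -> ex_series (fun n => Re (u n)).
Proof.
  apply ex_series_Rabs_le; intros; apply re_le_Cmod.
Qed.

Lemma Csummable_Im (u : nat -> C) : Csummable u -> ex_series (fun n => Im (u n)).
Proof.
  apply ex_series_Rabs_le; intros; apply im_le_Cmod.
Qed.

Lemma Csummable_scal (c : C) (u : nat -> C) :
  Csummable u -> Csummable (fun n => c * u n)%C.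
Proof.
  intros H; apply Csummable_le with (fun n => Cmod c * Cmod (u n)).
  - intros n; rewrite Cmod_mult; lra.
  - exact (ex_series_scal_l (Cmod c) _ H).
Qed.

Lemma Csummable_plus (u v : nat -> C) :
  Csummable u -> Csummable v -> Csummable (fun n => u n + v n)%C.
Proof.
  intros Hu Hv; apply Csummable_le with (fun n => Cmod (u n) + Cmod (v n)).
  - intros n; apply Cmod_triangle.
  - exact (ex_series_plus _ _ Hu Hv).
Qed.

Lemma Csummable_mult_bounded (w q : nat -> C) (B : R) :
  (forall n, Cmod (q n) <= B) -> Csummable w -> Csummable (fun n => w n * q n)%C.
Proof.
  intros HB Hw; apply Csummable_le with (fun n => B * Cmod (w n)).
  - intros n; rewrite Cmod_mult, Rmult_comm.
    apply Rmult_le_compat_r; auto using Cmod_ge_0.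
  - exact (ex_series_scal_l B _ Hw).
Qed.

Lemma CSeries_ext (u v : nat -> C) : (forall n, u n = v n) -> CSeries u = CSeries v.
Proof.
  intros H; unfold CSeries; f_equal; apply Series_ext; intros n; rewrite H; reflexivity.
Qed.

Lemma CSeries_plus (u v : nat -> C) : Csummable u -> Csummable v ->
  CSeries (fun n => u n + v n)%C = (CSeries u + CSeries v)%C.
Proof.
  intros Hu Hv; unfold CSeries, Cplus; simpl; f_equal; apply Series_plus;
    auto using Csummable_Re, Csummable_Im.
Qed.

Lemma CSeries_scal (c : C) (u : nat -> C) : Csummable u ->
  CSeries (fun n => c * u n)%C = (c * CSeries u)%C.
Proof.
  intros Hu; assert (H1 := Csummable_Re _ Hu); assert (H2 := Csummable_Im _ Hu).
  destruct c as [a b]; unfold CSeries, Cmult; simpl; f_equal.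
  - rewrite <- !Series_scal_l, <- Series_minus.
    + apply Series_ext; intros n; reflexivity.
    + exact (ex_series_scal_l a _ H1).
    + exact (ex_series_scal_l b _ H2).
  - rewrite <- !Series_scal_l, <- Series_plus.
    + apply Series_ext; intros n; reflexivity.
    + exact (ex_series_scal_l a _ H2).
    + exact (ex_series_scal_l b _ H1).
Qed.

Lemma CSeries_minus (u v : nat -> C) : Csummable u -> Csummable v ->
  CSeries (fun n => u n - v n)%C = (CSeries u - CSeries v)%C.
Proof.
  intros Hu Hv.
  rewrite (CSeries_ext _ (fun n => u n + (-1) * v n)%C) by (intros; ring).
  rewrite CSeries_plus, CSeries_scal; auto using Csummable_scal; ring.
Qed.

Lemma Rabs_Series_le (u v : nat -> R) :
  (forall n, Rabs (u n) <= v n) -> ex_series v -> Rabs (Series u) <= Series v.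
Proof.
  intros H Hv.
  assert (ex_series (fun n => Rabs (u n)))
    by (apply ex_series_Rabs_le with v; auto; intros; rewrite Rabs_Rabsolu; auto).
  eapply Rle_trans; [apply Series_Rabs; auto|].
  apply Series_le; auto; intros; split; auto using Rabs_pos.
Qed.

(** The factor 2 comes from bounding the real and the imaginary part of the sum separately, each by
    [Series v]. *)
Lemma Cmod_CSeries_le (u : nat -> C) (v : nat -> R) :
  (forall n, Cmod (u n) <= v n) -> ex_series v -> Cmod (CSeries u) <= 2 * Series v.
Proof.
  intros H Hv; eapply Rle_trans; [apply Cmod_le_Re_Im|]; simpl.
  assert (A : forall n, Rabs (Re (u n)) <= v n)
    by (intros n; eapply Rle_trans; [apply re_le_Cmod | auto]).
  assert (B : forall n, Rabs (Im (u n)) <= v n)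
    by (intros n; eapply Rle_trans; [apply im_le_Cmod | auto]).
  assert (A' := Rabs_Series_le _ _ A Hv).
  assert (B' := Rabs_Series_le _ _ B Hv).
  lra.
Qed.

(** * Complex derivatives and the exponential *)

Lemma is_C_derive_eps (f : C -> C) (x l : C) :
  (forall eps, 0 < eps -> exists delta, 0 < delta /\ forall y, Cmod (y - x) < delta ->
     Cmod (f y - f x - (y - x) * l) <= eps * Cmod (y - x)) ->
  @is_derive C_AbsRing (AbsRing_NormedModule C_AbsRing) f x l.
Proof.
  intros H; split.
  - apply (is_linear_scal_l (K := C_AbsRing) (V := AbsRing_NormedModule C_AbsRing)).
  - intros x' Hx'.
    assert (E := is_filter_lim_locally_unique _ _ Hx'); subst x'.
    intros eps; destruct (H eps (cond_pos eps)) as [d [Hd Hy]].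
    exists (mkposreal d Hd); intros y By; apply Hy; exact By.
Qed.

(** [C] carries two normed module structures whose remainder estimates are convertible: the product
    rule uses [AbsRing_NormedModule C_AbsRing], whereas [analytic_on_Cplus] speaks of
    [C_NormedModule]. *)
Lemma is_C_derive_NormedModule (f : C -> C) (x l : C) :
  @is_derive C_AbsRing (AbsRing_NormedModule C_AbsRing) f x l ->
  @is_derive C_AbsRing C_NormedModule f x l.
Proof.
  intros [_ H]; split.
  - apply (is_linear_scal_l (K := C_AbsRing) (V := C_NormedModule)).
  - exact H.
Qed.

Lemma is_C_derive_quadratic (f : C -> C) (x l : C) (d B : R) :
  0 < d ->
  (forall y, Cmod (y - x) < d ->
     Cmod (f y - f x - (y - x) * l) <= B * Cmod (y - x) ^ 2) ->
  @is_derive C_AbsRing (AbsRing_NormedModule C_AbsRing) f x l.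
Proof.
  intros Hd H; apply is_C_derive_eps; intros eps Heps.
  assert (HB : 0 < Rabs B + 1) by (assert (H0 := Rabs_pos B); lra).
  (* [Rabs B + 1] is positive whatever the sign of [B], and [t < eps / (Rabs B + 1)] turns
     [B * t ^ 2] into at most [eps * t]. *)
  exists (Rmin d (eps / (Rabs B + 1))); split.
  - apply Rmin_glb_lt; auto; apply Rdiv_lt_0_compat; auto.
  - intros y Hy.
    assert (Hy1 : Cmod (y - x) < d) by (eapply Rlt_le_trans; [apply Hy | apply Rmin_l]).
    assert (Hy2 : Cmod (y - x) < eps / (Rabs B + 1))
      by (eapply Rlt_le_trans; [apply Hy | apply Rmin_r]).
    eapply Rle_trans; [apply H; auto|].
    set (t := Cmod (y - x)) in *.
    assert (Ht : 0 <= t) by apply Cmod_ge_0.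
    assert (H1 : t * (Rabs B + 1) <= eps).
    { apply Rlt_le, Rmult_lt_reg_r with (/ (Rabs B + 1)).
      - apply Rinv_0_lt_compat; auto.
      - replace (t * (Rabs B + 1) * / (Rabs B + 1)) with t by (field; lra); exact Hy2. }
    assert (H2 := Rle_abs B).
    nra.
Qed.

Lemma exp_cos_sin_near_0 (eps : R) : 0 < eps -> exists d, 0 < d /\
  forall x, Rabs x < d -> Rabs (exp x - 1 - x) <= eps * Rabs x /\
     Rabs (cos x - 1) <= eps * Rabs x /\ Rabs (sin x - x) <= eps * Rabs x.
Proof.
  intros He.
  assert (A : forall (f : R -> R) l, is_derive f 0 l -> exists d, 0 < d /\
     forall x, Rabs x < d -> Rabs (f x - f 0 - x * l) <= eps * Rabs x).
  { intros f l [_ H].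
    (* The identity function proves that 0 is a limit of its own neighbourhood filter. *)
    destruct (H 0 (fun P HP => HP) (mkposreal eps He)) as [d Hd].
    exists d; split; [apply cond_pos|]; intros x Hx.
    assert (Hx' : ball (0 : R_UniformSpace) d x).
    { unfold ball; simpl; unfold AbsRing_ball, abs, minus, plus, opp; simpl.
      rewrite Ropp_0, Rplus_0_r; exact Hx. }
    specialize (Hd x Hx').
    unfold norm, minus, plus, opp, scal in Hd; simpl in Hd.
    unfold abs, mult in Hd; simpl in Hd.
    replace (x + - 0) with x in Hd by ring; exact Hd. }
  destruct (A exp 1) as [d1 [P1 H1]].
  { rewrite <- exp_0; apply is_derive_exp. }
  destruct (A cos 0) as [d2 [P2 H2]].
  { replace 0 with (- sin 0) at 2 by (rewrite sin_0; ring); apply is_derive_cos. }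
  destruct (A sin 1) as [d3 [P3 H3]].
  { rewrite <- cos_0; apply is_derive_sin. }
  exists (Rmin d1 (Rmin d2 d3)); split.
  - repeat apply Rmin_glb_lt; auto.
  - intros x Hx.
    assert (L1 := Rmin_l d1 (Rmin d2 d3)); assert (L2 := Rmin_r d1 (Rmin d2 d3)).
    assert (L3 := Rmin_l d2 d3); assert (L4 := Rmin_r d2 d3).
    specialize (H1 x); specialize (H2 x); specialize (H3 x).
    rewrite exp_0 in H1; rewrite cos_0 in H2; rewrite sin_0 in H3.
    repeat split.
    + replace (exp x - 1 - x) with (exp x - 1 - x * 1) by ring; apply H1; lra.
    + replace (cos x - 1) with (cos x - 1 - x * 0) by ring; apply H2; lra.
    + replace (sin x - x) with (sin x - 0 - x * 1) by ring; apply H3; lra.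
Qed.

Lemma Cexp_plus (s t : C) : Cexp (s + t) = (Cexp s * Cexp t)%C.
Proof.
  destruct s as [a b], t as [c d]; unfold Cexp, Cmult; simpl.
  rewrite exp_plus, cos_plus, sin_plus; f_equal; ring.
Qed.

Lemma Cmod_Cexp (s : C) : Cmod (Cexp s) = exp (Re s).
Proof.
  assert (E : Cmod (Cexp s) ^ 2 = exp (Re s) ^ 2).
  { rewrite Cmod2_alt; unfold Cexp; simpl.
    assert (H := sin2_cos2 (Im s)); unfold Rsqr in H.
    replace (exp (Re s) * cos (Im s) * (exp (Re s) * cos (Im s) * 1) +
      exp (Re s) * sin (Im s) * (exp (Re s) * sin (Im s) * 1))
    with (exp (Re s) * exp (Re s) *
       (sin (Im s) * sin (Im s) + cos (Im s) * cos (Im s))) by ring.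
    rewrite H; ring. }
  assert (H1 := exp_pos (Re s)); assert (H2 := Cmod_ge_0 (Cexp s)); nra.
Qed.

(** By [Cexp_plus] the remainder at [s] is [Cexp s] times the remainder [Cexp h - 1 - h] at 0, which
    the real expansions of exp, cos and sin control. *)
Lemma is_C_derive_Cexp (s : C) :
  @is_derive C_AbsRing (AbsRing_NormedModule C_AbsRing) Cexp s (Cexp s).
Proof.
  apply is_C_derive_eps; intros eps Heps.
  (* The 7 adds up the errors below: [1 + 2] for the real part and [1 + 2 + 1] for the imaginary
     part, each in units of [e0 * Cmod h]. The minimum with 1 gives [Rabs (1 + a) <= 2]. *)
  set (e0 := Rmin 1 (eps / (7 * exp (Re s)))).
  assert (Hexp := exp_pos (Re s)).
  assert (He0 : 0 < e0).
  { apply Rmin_glb_lt; [lra|]; apply Rdiv_lt_0_compat; lra. }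
  destruct (exp_cos_sin_near_0 e0 He0) as [d [Hd H]].
  exists (Rmin d e0); split; [apply Rmin_glb_lt; auto|].
  intros y Hy.
  set (h := (y - s)%C) in *.
  replace y with (s + h)%C by (unfold h; ring).
  rewrite Cexp_plus.
  replace (Cexp s * Cexp h - Cexp s - h * Cexp s)%C
    with (Cexp s * (Cexp h - 1 - h))%C by ring.
  rewrite Cmod_mult, Cmod_Cexp.
  assert (K : Cmod (Cexp h - 1 - h) <= 7 * e0 * Cmod h).
  { assert (L1 := Rmin_l d e0); assert (L2 := Rmin_r d e0).
    assert (L3 : e0 <= 1) by apply Rmin_l.
    assert (R1 := re_le_Cmod h); assert (R2 := im_le_Cmod h).
    set (r := Cmod h) in *.
    destruct h as [a b]; simpl in R1, R2.
    destruct (H a) as [A1 _]; [lra|].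
    destruct (H b) as [_ [B1 B2]]; [lra|].
    eapply Rle_trans; [apply Cmod_le_Re_Im|]; unfold Cexp; simpl.
    replace (exp a * cos b + - (1) + - a)
      with ((exp a - 1 - a) * cos b + (1 + a) * (cos b - 1)) by ring.
    replace (exp a * sin b + - 0 + - b)
      with ((exp a - 1 - a) * sin b + (1 + a) * (sin b - b) + a * b) by ring.
    assert (C1 : Rabs (cos b) <= 1) by (apply Rabs_le; apply COS_bound).
    assert (C2 : Rabs (sin b) <= 1) by (apply Rabs_le; apply SIN_bound).
    assert (C3 : Rabs (1 + a) <= 2).
    { eapply Rle_trans; [apply Rabs_triang|]; rewrite Rabs_R1; lra. }
    assert (M : forall u v p q, Rabs u <= p -> Rabs v <= q -> Rabs (u * v) <= p * q).
    { intros; rewrite Rabs_mult; apply Rmult_le_compat; auto using Rabs_pos. }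
    assert (D1 : e0 * Rabs a <= e0 * r) by (apply Rmult_le_compat_l; lra).
    assert (D2 : e0 * Rabs b <= e0 * r) by (apply Rmult_le_compat_l; lra).
    assert (E1 : Rabs ((exp a - 1 - a) * cos b) <= e0 * r * 1) by (apply M; lra).
    assert (E2 : Rabs ((1 + a) * (cos b - 1)) <= 2 * (e0 * r)) by (apply M; lra).
    assert (E3 : Rabs ((exp a - 1 - a) * sin b) <= e0 * r * 1) by (apply M; lra).
    assert (E4 : Rabs ((1 + a) * (sin b - b)) <= 2 * (e0 * r)) by (apply M; lra).
    assert (E5 : Rabs (a * b) <= e0 * r) by (apply M; lra).
    assert (T1 := Rabs_triang ((exp a - 1 - a) * cos b) ((1 + a) * (cos b - 1))).
    assert (T2 := Rabs_triang ((exp a - 1 - a) * sin b + (1 + a) * (sin b - b)) (a * b)).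
    assert (T3 := Rabs_triang ((exp a - 1 - a) * sin b) ((1 + a) * (sin b - b))).
    lra. }
  assert (Q : 7 * exp (Re s) * e0 <= eps).
  { assert (L : e0 <= eps / (7 * exp (Re s))) by apply Rmin_r.
    apply Rmult_le_compat_l with (r := 7 * exp (Re s)) in L; [|lra].
    replace (7 * exp (Re s) * (eps / (7 * exp (Re s)))) with eps in L by (field; lra).
    exact L. }
  assert (Hm := Cmod_ge_0 h).
  apply Rle_trans with (exp (Re s) * (7 * e0 * Cmod h)).
  - apply Rmult_le_compat_l; lra.
  - replace (exp (Re s) * (7 * e0 * Cmod h)) with (7 * exp (Re s) * e0 * Cmod h) by ring.
    apply Rmult_le_compat_r; auto.
Qed.

(** * Power series and complex derivative of sums of kernels [1 / (1 - x_j z)^2] *)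

Lemma ex_series_pos_bounded (u : nat -> R) (M : R) :
  (forall n, 0 <= u n) -> (forall n, sum_n u n <= M) ->
  ex_series u /\ Series u <= M.
Proof.
  intros Hu HM.
  assert (E : ex_finite_lim_seq (sum_n u)).
  { apply ex_finite_lim_seq_incr with M; auto.
    intros n; rewrite sum_Sn; unfold plus; simpl; specialize (Hu (S n)); lra. }
  destruct E as [l Hl].
  assert (Hs : is_series u l) by exact Hl.
  split; [exists l; exact Hs|].
  rewrite (is_series_unique _ _ Hs).
  change (Rbar_le l M).
  apply (is_lim_seq_le (sum_n u) (fun _ => M) l M); auto; apply is_lim_seq_const.
Qed.

(** These are the terms of a convergent series: its partial sums have a closed form and stay below
    [1 / (1 - r)^2]. *)
Lemma is_lim_seq_arith_geom (r : R) : 0 <= r < 1 ->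
  is_lim_seq (fun K => INR (S K) * r ^ K) 0.
Proof.
  intros Hr; apply ex_series_lim_0.
  assert (Hpow : forall K, 0 <= r ^ K) by (intros; apply pow_le; lra).
  apply (ex_series_pos_bounded (fun K => INR (S K) * r ^ K) (/ (1 - r) ^ 2)).
  - intros n; apply Rmult_le_pos; [apply pos_INR | auto].
  - assert (E : forall K, (1 - r) ^ 2 * sum_n (fun K => INR (S K) * r ^ K) K =
       1 - r ^ S K * (INR (S (S K)) - INR (S K) * r)).
    { induction K.
      - rewrite sum_O; simpl; ring.
      - rewrite sum_Sn; change (@plus R_AbelianMonoid) with Rplus.
        rewrite Rmult_plus_distr_l, IHK, !S_INR; simpl pow; ring. }
    intros K; apply Rmult_le_reg_l with ((1 - r) ^ 2).
    + apply pow_lt; lra.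
    + rewrite E, Rinv_r by (apply pow_nonzero; lra).
      assert (P := Hpow (S K)); assert (I := pos_INR (S K)).
      rewrite (S_INR (S K)).
      assert (Q : 0 <= r ^ S K * (INR (S K) + 1 - INR (S K) * r))
        by (apply Rmult_le_pos; [exact P | nra]).
      lra.
Qed.

Lemma is_C_series_of_remainder (a : nat -> C) (l : C) (b : nat -> R) :
  (forall K, Cmod (l - sum_n (G := C_NormedModule) a K) <= b K) ->
  is_lim_seq b 0 -> @is_series C_AbsRing C_NormedModule a l.
Proof.
  intros H Hb; unfold is_series.
  apply (filterlim_locally_ball_norm (K := C_AbsRing) (U := C_NormedModule)).
  intros eps.
  apply is_lim_seq_spec in Hb; destruct (Hb eps) as [N HN].
  exists N; intros n Hn; specialize (HN n Hn).
  unfold ball_norm; change (Cmod (sum_n (G := C_NormedModule) a n - l) < eps).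
  replace (sum_n (G := C_NormedModule) a n - l)%C
    with (- (l - sum_n (G := C_NormedModule) a n))%C by ring.
  rewrite Cmod_opp; eapply Rle_lt_trans; [apply H|].
  assert (Q := Rle_abs (b n - 0)); lra.
Qed.

Lemma Cmod_one_minus_ge (a : R) (z : C) :
  0 <= a <= 1 -> 1 - Cmod z <= Cmod (1 - a * z).
Proof.
  intros Ha; eapply Rle_trans; [|apply Cmod_sub_ge].
  rewrite Cmod_1, Cmod_mult, Cmod_R, Rabs_pos_eq by lra.
  assert (H := Cmod_ge_0 z); nra.
Qed.

Lemma Cmod_one_minus_le (a : R) (z : C) :
  0 <= a <= 1 -> Cmod z <= 1 -> Cmod (1 - a * z) <= 2.
Proof.
  intros Ha Hz; eapply Rle_trans; [apply Cmod_sub_le|].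
  rewrite Cmod_1, Cmod_mult, Cmod_R, Rabs_pos_eq by lra.
  assert (H := Cmod_ge_0 z); nra.
Qed.

(** An exact remainder for the differentiated geometric series; it yields a bound uniform over all
    [u] with [|u| <= r < 1]. *)
Lemma inv_square_series_remainder (u : C) (K : nat) : (1 - u)%C <> 0 ->
  (/ (1 - u) ^ 2 - sum_n (G := C_NormedModule) (fun k => RtoC (INR (S k)) * u ^ k) K)%C =
  (u ^ S K * (RtoC (INR (S (S K))) - RtoC (INR (S K)) * u) / (1 - u) ^ 2)%C.
Proof.
  intros Hu; induction K.
  - rewrite sum_O; simpl; rewrite !RtoC_plus; field; auto.
  - rewrite sum_Sn.
    change (@plus (NormedModule.AbelianMonoid C_AbsRing C_NormedModule)) with Cplus.
    match goal with |- (?a - (?s + ?t))%C = _ =>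
      replace (a - (s + t))%C with ((a - s) - t)%C by ring end.
    rewrite IHK, (S_INR (S (S K))), (S_INR (S K)), !RtoC_plus, !Cpow_S.
    field; auto.
Qed.

(** With weights [w_j = c_j (1 - x_j^2)] this is the interpolating function [sum_j c_j h_j] without
    its common factor [1 - z^2]. *)
Definition kernel_sum (w : nat -> C) (x : nat -> R) (z : C) : C :=
  CSeries (fun j => w j * / (1 - x j * z) ^ 2)%C.

(** Each kernel is expanded in powers of [z] and the two sums are exchanged. On partial sums in [k]
    the exchange is mere linearity; the remainders are bounded uniformly in [j] and weighted by the
    summable [w]. *)
Lemma kernel_sum_power_series (w : nat -> C) (x : nat -> R) (z : C) :
  Csummable w -> (forall j, 0 <= x j <= 1) -> Cmod z < 1 ->
  @is_series C_AbsRing C_NormedModule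
    (fun k => RtoC (INR (S k)) * CSeries (fun j => w j * RtoC (x j) ^ k) * z ^ k)%C
    (kernel_sum w x z).
Proof.
  intros Hw Hx Hz.
  assert (Hr := Cmod_ge_0 z); set (r := Cmod z) in *.
  (* [p j K] is the expansion of the [j]-th kernel truncated at order [K]. *)
  set (p := fun j K => sum_n (G := C_NormedModule)
              (fun k => RtoC (INR (S k)) * (x j * z) ^ k)%C K).
  assert (Hxp : forall k, Csummable (fun j => w j * RtoC (x j) ^ k)%C).
  { intros k; apply Csummable_mult_bounded with 1; auto.
    intros j; rewrite Cmod_pow, Cmod_R, Rabs_pos_eq by apply Hx.
    rewrite <- (pow1 k); apply pow_incr; apply Hx. }
  assert (HK : forall K, Csummable (fun j => w j * p j K)%C /\
     sum_n (G := C_NormedModule)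
       (fun k => RtoC (INR (S k)) * CSeries (fun j => w j * RtoC (x j) ^ k) * z ^ k)%C K
     = CSeries (fun j => w j * p j K)%C).
  { assert (Step : forall k,
      Csummable (fun j => w j * (RtoC (INR (S k)) * (x j * z) ^ k))%C /\
      (RtoC (INR (S k)) * CSeries (fun j => w j * RtoC (x j) ^ k) * z ^ k)%C =
      CSeries (fun j => w j * (RtoC (INR (S k)) * (x j * z) ^ k))%C).
    { intros k.
      assert (E : forall j, (w j * (RtoC (INR (S k)) * (x j * z) ^ k))%C =
        ((RtoC (INR (S k)) * z ^ k) * (w j * RtoC (x j) ^ k))%C).
      { intros j; rewrite Cpow_mult_l; ring. }
      split.
      - eapply Csummable_le; [intros j; rewrite E; apply Rle_refl|].
        apply (Csummable_scal (RtoC (INR (S k)) * z ^ k)%C _ (Hxp k)).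
      - rewrite (CSeries_ext _ _ E), CSeries_scal by auto; ring. }
    induction K.
    - unfold p; destruct (Step 0%nat) as [S1 S2]; split.
      + eapply Csummable_le; [intros j; rewrite sum_O; apply Rle_refl | exact S1].
      + rewrite sum_O, S2; apply CSeries_ext; intros j; rewrite sum_O; reflexivity.
    - destruct IHK as [I1 I2]; destruct (Step (S K)) as [S1 S2].
      assert (E : forall j, (w j * p j (S K))%C =
        (w j * p j K + w j * (RtoC (INR (S (S K))) * (x j * z) ^ S K))%C).
      { intros j; unfold p; rewrite sum_Sn.
        change (@plus (NormedModule.AbelianMonoid C_AbsRing C_NormedModule)) with Cplus.
        ring. }
      split.
      + eapply Csummable_le; [intros j; rewrite E; apply Rle_refl|].
        apply (Csummable_plus _ _ I1 S1).
      + rewrite sum_Sn, I2, S2, (CSeries_ext _ _ E), CSeries_plus; auto. }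
  assert (Hge : forall j, 1 - r <= Cmod (1 - x j * z)) by (intros; apply Cmod_one_minus_ge; auto).
  assert (Hnz : forall j, (1 - x j * z)%C <> 0)
    by (intros; apply Cmod_gt_0; specialize (Hge j); lra).
  assert (Hsum : Csummable (fun j => w j * / (1 - x j * z) ^ 2)%C).
  { apply Csummable_mult_bounded with (/ (1 - r) ^ 2); auto; intros j.
    rewrite Cmod_inv by (apply Cpow_nz; auto); rewrite Cmod_pow.
    apply Rinv_le_contravar; [apply pow_lt; lra | apply pow_incr; split; auto; lra]. }
  (* The 2 comes from [Cmod_CSeries_le], the 3 from [(K + 2) + (K + 1) r <= 3 (K + 1)]. *)
  apply is_C_series_of_remainder with
    (fun K => 2 * Series (fun j => Cmod (w j)) * (3 / (1 - r) ^ 2) * (INR (S K) * r ^ K)).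
  - intros K; destruct (HK K) as [S1 ->].
    unfold kernel_sum; rewrite <- CSeries_minus by auto.
    replace (2 * Series (fun j => Cmod (w j)) * (3 / (1 - r) ^ 2) * (INR (S K) * r ^ K))
      with (2 * Series (fun j => Cmod (w j) * (3 / (1 - r) ^ 2 * (INR (S K) * r ^ K))))
      by (rewrite Series_scal_r; ring).
    apply Cmod_CSeries_le; [|apply ex_series_scal_r; exact Hw].
    intros j.
    replace (w j * / (1 - x j * z) ^ 2 - w j * p j K)%C
      with (w j * (/ (1 - x j * z) ^ 2 - p j K))%C by ring.
    unfold p; rewrite inv_square_series_remainder by auto.
    rewrite Cmod_mult; apply Rmult_le_compat_l; [apply Cmod_ge_0|].
    rewrite Cmod_div by (apply Cpow_nz; auto).
    rewrite Cmod_mult, !Cmod_pow.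
    assert (Hu : Cmod (x j * z) <= r).
    { rewrite Cmod_mult, Cmod_R, Rabs_pos_eq by apply Hx; fold r.
      destruct (Hx j); nra. }
    assert (N1 : Cmod (x j * z) ^ S K <= r ^ K).
    { apply Rle_trans with (r ^ S K); [apply pow_incr; split; auto using Cmod_ge_0|].
      simpl; assert (0 <= r ^ K) by (apply pow_le; auto); nra. }
    assert (N2 : Cmod (RtoC (INR (S (S K))) - RtoC (INR (S K)) * (x j * z)) <= 3 * INR (S K)).
    { eapply Rle_trans; [apply Cmod_sub_le|].
      rewrite Cmod_mult, !Cmod_R, !Rabs_pos_eq by apply pos_INR.
      rewrite !S_INR; assert (I := pos_INR K); nra. }
    assert (N3 : / Cmod (1 - x j * z) ^ 2 <= / (1 - r) ^ 2).
    { apply Rinv_le_contravar; [apply pow_lt; lra | apply pow_incr; split; auto; lra]. }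
    replace (3 / (1 - r) ^ 2 * (INR (S K) * r ^ K))
      with (r ^ K * (3 * INR (S K)) * / (1 - r) ^ 2) by (field; lra).
    unfold Rdiv; apply Rmult_le_compat; auto.
    + apply Rmult_le_pos; [apply pow_le|]; apply Cmod_ge_0.
    + apply Rlt_le, Rinv_0_lt_compat, pow_lt; specialize (Hge j); lra.
    + apply Rmult_le_compat; auto; [apply pow_le|]; apply Cmod_ge_0.
  - replace (Finite 0) with
      (Rbar_mult (2 * Series (fun j => Cmod (w j)) * (3 / (1 - r) ^ 2)) 0)
      by (simpl; f_equal; ring).
    apply is_lim_seq_scal_l, is_lim_seq_arith_geom; lra.
Qed.

(** Termwise differentiation: near [z] the second-order remainders of the kernels are bounded by one
    constant times [|y - z|^2], independently of [j]. *)
Lemma is_C_derive_kernel_sum (w : nat -> C) (x : nat -> R) (z : C) :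
  Csummable w -> (forall j, 0 <= x j <= 1) -> Cmod z < 1 ->
  @is_derive C_AbsRing (AbsRing_NormedModule C_AbsRing) (kernel_sum w x) z
    (CSeries (fun j => w j * (2 * x j / (1 - x j * z) ^ 3))%C).
Proof.
  intros Hw Hx Hz.
  (* Half the distance to the unit circle, so that [1 - |y| >= d] still holds when [|y - z| < d]. *)
  set (d := (1 - Cmod z) / 2).
  assert (Hd : 0 < d) by (unfold d; lra).
  assert (Hge : forall y j, Cmod (y - z) < d -> d <= Cmod (1 - x j * y)).
  { intros y j Hy; eapply Rle_trans; [|apply Cmod_one_minus_ge; auto].
    assert (H := Cmod_sub_ge y z); unfold d in *; lra. }
  assert (Hy1 : forall y, Cmod (y - z) < d -> Cmod y <= 1).
  { intros y Hy; assert (H := Cmod_sub_ge y z); unfold d in *; lra. }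
  assert (Hzz : Cmod (z - z) < d)
    by (replace (z - z)%C with (RtoC 0) by ring; rewrite Cmod_0; auto).
  assert (Hnz : forall y j, Cmod (y - z) < d -> (1 - x j * y)%C <> 0)
    by (intros y j Hy; apply Cmod_gt_0; specialize (Hge y j Hy); lra).
  assert (Hinv : forall n y j, Cmod (y - z) < d -> Cmod (/ (1 - x j * y) ^ n) <= / d ^ n).
  { intros n y j Hy; rewrite Cmod_inv by (apply Cpow_nz; auto); rewrite Cmod_pow.
    apply Rinv_le_contravar; [apply pow_lt; auto | apply pow_incr; split; auto; lra]. }
  assert (Hs : forall y, Cmod (y - z) < d -> Csummable (fun j => w j * / (1 - x j * y) ^ 2)%C).
  { intros y Hy; apply Csummable_mult_bounded with (/ d ^ 2); auto. }
  assert (Hl : Csummable (fun j => w j * (2 * x j / (1 - x j * z) ^ 3))%C).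
  { apply Csummable_mult_bounded with (2 * / d ^ 3); auto.
    intros j; unfold Cdiv; rewrite !Cmod_mult, !Cmod_R, !Rabs_pos_eq by (try apply Hx; lra).
    apply Rmult_le_compat; auto using Cmod_ge_0; destruct (Hx j); lra. }
  (* The 6 bounds [|1 - x_j z| + 2 |1 - x_j y|], both moduli being at most 2; [/ d ^ 5] bounds the
     inverse cube times the inverse square. The leading 2 is that of [Cmod_CSeries_le]. *)
  apply is_C_derive_quadratic with d (2 * (Series (fun j => Cmod (w j)) * (6 * / d ^ 5))); auto.
  intros y Hy; unfold kernel_sum.
  rewrite <- CSeries_minus by auto.
  rewrite <- CSeries_scal by auto.
  rewrite <- CSeries_minus; auto using Csummable_scal.
  2:{ eapply Csummable_le; [intros j; apply Cmod_sub_le|].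
      exact (ex_series_plus _ _ (Hs y Hy) (Hs z Hzz)). }
  replace (2 * (Series (fun j => Cmod (w j)) * (6 * / d ^ 5)) * Cmod (y - z) ^ 2)
    with (2 * Series (fun j => Cmod (w j) * (6 * / d ^ 5 * Cmod (y - z) ^ 2)))
    by (rewrite Series_scal_r; ring).
  apply Cmod_CSeries_le; [|apply ex_series_scal_r; exact Hw].
  intros j.
  (* With p = 1 - a z and q = 1 - a y the remainder is a^2 (y - z)^2 (p + 2 q) / (p^3 q^2). *)
  replace (w j * / (1 - x j * y) ^ 2 - w j * / (1 - x j * z) ^ 2 -
     (y - z) * (w j * (2 * x j / (1 - x j * z) ^ 3)))%C
    with (w j * ((RtoC (x j) ^ 2 * ((1 - x j * z) + 2 * (1 - x j * y))) *
      (/ (1 - x j * z) ^ 3 * / (1 - x j * y) ^ 2) * (y - z) ^ 2))%C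
    by (field; split; auto).
  rewrite Cmod_mult; apply Rmult_le_compat_l; [apply Cmod_ge_0|].
  rewrite Cmod_mult, Cmod_pow; apply Rmult_le_compat_r; [apply pow_le, Cmod_ge_0|].
  rewrite Cmod_mult; apply Rmult_le_compat; try apply Cmod_ge_0.
  - rewrite Cmod_mult, Cmod_pow, Cmod_R, Rabs_pos_eq by apply Hx.
    assert (P1 : x j ^ 2 <= 1) by (destruct (Hx j); nra).
    assert (P0 : 0 <= x j ^ 2) by apply pow2_ge_0.
    assert (P2 : Cmod ((1 - x j * z) + 2 * (1 - x j * y)) <= 6).
    { eapply Rle_trans; [apply Cmod_triangle|].
      rewrite Cmod_mult, Cmod_R, Rabs_pos_eq by lra.
      assert (Q1 := Cmod_one_minus_le _ _ (Hx j) (Hy1 _ Hy)).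
      assert (Q2 := Cmod_one_minus_le _ _ (Hx j) (Hy1 _ Hzz)); lra. }
    assert (P3 := Cmod_ge_0 ((1 - x j * z) + 2 * (1 - x j * y))); nra.
  - rewrite Cmod_mult.
    replace (/ d ^ 5) with (/ d ^ 3 * / d ^ 2) by (field; lra).
    apply Rmult_le_compat; auto using Cmod_ge_0.
Qed.

(** * Solving the interpolation system by a Neumann series *)

Lemma Series_tail_geometric (v : nat -> R) (M q : R) (K : nat) :
  0 <= q < 1 -> (forall m, Rabs (v m) <= M * q ^ m) ->
  Rabs (Series v - sum_n v K) <= M / (1 - q) * q ^ S K.
Proof.
  intros Hq Hv.
  assert (Hg : ex_series (fun m => q ^ m))
    by (exists (/ (1 - q)); apply is_series_geom; rewrite Rabs_pos_eq; lra).
  assert (Hs : ex_series v).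
  { apply ex_series_Rabs_le with (fun m => M * q ^ m); auto.
    exact (ex_series_scal_l M _ Hg). }
  rewrite (Series_incr_n v (S K)) by (auto; lia).
  simpl pred; rewrite sum_n_Reals.
  replace (sum_f_R0 v K + Series (fun k => v (S K + k)%nat) - sum_f_R0 v K)
    with (Series (fun k => v (S K + k)%nat)) by ring.
  replace (M / (1 - q) * q ^ S K) with (Series (fun k => M * q ^ S K * q ^ k)).
  - apply Rabs_Series_le.
    + intros k; rewrite Rmult_assoc, <- pow_add; apply Hv.
    + exact (ex_series_scal_l (M * q ^ S K) _ Hg).
  - rewrite Series_scal_l, Series_geom by (rewrite Rabs_pos_eq; lra).
    unfold Rdiv; ring.
Qed.

(** The matrix [E] acts on bounded sequences with sup norm at most [q < 1], so
    [c = sum_m (-E)^m alpha] converges geometrically and solves [c + E c = alpha]. *)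
Lemma neumann_bounded_inverse (E : nat -> nat -> R) (e alpha : nat -> R) (q M : R) :
  (forall n j, Rabs (E n j) <= e j) -> ex_series e -> Series e <= q -> 0 <= q < 1 ->
  (forall n, Rabs (alpha n) <= M) ->
  exists c : nat -> R, (exists M', forall n, Rabs (c n) <= M') /\
    forall n, c n + Series (fun j => E n j * c j) = alpha n.
Proof.
  intros HE He Hq Hq1 HM.
  assert (HM0 : 0 <= M) by (eapply Rle_trans; [apply Rabs_pos | apply (HM 0%nat)]).
  assert (Hbd : forall (u : nat -> R) B n, (forall j, Rabs (u j) <= B) ->
     ex_series (fun j => E n j * u j) /\ Rabs (Series (fun j => E n j * u j)) <= B * q).
  { intros u B n Hu.
    assert (HB0 : 0 <= B) by (eapply Rle_trans; [apply Rabs_pos | apply (Hu 0%nat)]).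
    assert (Hj : forall j, Rabs (E n j * u j) <= B * e j).
    { intros j; rewrite Rabs_mult, Rmult_comm.
      apply Rmult_le_compat; auto using Rabs_pos. }
    assert (Hse : ex_series (fun j => B * e j)) by exact (ex_series_scal_l B _ He).
    split; [apply ex_series_Rabs_le with (fun j => B * e j); auto|].
    eapply Rle_trans; [apply (Rabs_Series_le _ _ Hj Hse)|].
    rewrite Series_scal_l; apply Rmult_le_compat_l; auto. }
  (* [v m] is [(-E)^m alpha] and [P K] below is the [K]-th partial sum of the Neumann series. *)
  set (v := fix v (m : nat) : nat -> R :=
     match m with
     | O => alpha
     | S m' => fun n => - Series (fun j => E n j * v m' j)
     end).
  assert (Hv : forall m n, Rabs (v m n) <= M * q ^ m).
  { induction m; intros n; simpl.
    - rewrite Rmult_1_r; auto.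
    - rewrite Rabs_Ropp.
      replace (M * (q * q ^ m)) with (M * q ^ m * q) by ring; apply Hbd; auto. }
  set (P := fun K n => sum_n (fun m => v m n) K).
  set (c := fun n => Series (fun m => v m n)).
  assert (Hc : forall K n, Rabs (c n - P K n) <= M / (1 - q) * q ^ S K)
    by (intros; apply Series_tail_geometric; auto).
  assert (Hg : ex_series (fun m => M * q ^ m)).
  { apply (ex_series_scal_l M (fun m => q ^ m)).
    exists (/ (1 - q)); apply is_series_geom; rewrite Rabs_pos_eq; lra. }
  assert (Hcb : forall n, Rabs (c n) <= Series (fun m => M * q ^ m))
    by (intros; apply Rabs_Series_le; auto).
  exists c; split; [exists (Series (fun m => M * q ^ m)); auto|].
  intros n.
  (* Telescoping: [E] maps the sum of the first terms to minus the sum of the next ones, which lacks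
     only [alpha]. *)
  assert (HP : forall K, ex_series (fun j => E n j * P K j) /\
     Series (fun j => E n j * P K j) = alpha n - P (S K) n).
  { induction K.
    - unfold P; split.
      + apply ex_series_ext with (fun j => E n j * v 0%nat j).
        * intros j; rewrite sum_O; reflexivity.
        * apply (Hbd _ M); intros j; simpl; auto.
      + rewrite sum_Sn, sum_O; change (@plus R_AbelianMonoid) with Rplus.
        rewrite (Series_ext _ (fun j => E n j * v 0%nat j))
          by (intros j; rewrite sum_O; reflexivity).
        simpl; ring.
    - destruct IHK as [I1 I2].
      destruct (Hbd (v (S K)) (M * q ^ S K) n (Hv (S K))) as [B1 _].
      assert (Ext : forall j, E n j * P (S K) j = E n j * P K j + E n j * v (S K) j).
      { intros j; unfold P; rewrite sum_Sn.
        change (@plus R_AbelianMonoid) with Rplus; ring. }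
      split.
      + apply ex_series_ext with (fun j => E n j * P K j + E n j * v (S K) j).
        * intros j; symmetry; apply Ext.
        * exact (ex_series_plus _ _ I1 B1).
      + rewrite (Series_ext _ _ Ext), Series_plus, I2 by auto.
        replace (P (S (S K)) n)
          with (P (S K) n - Series (fun j => E n j * v (S K) j))
          by (unfold P at 2; rewrite sum_Sn; reflexivity).
        ring. }
  assert (Hlim : is_lim_seq (fun K => 2 * (M / (1 - q)) * q ^ S K) 0).
  { replace (Finite 0) with (Rbar_mult (2 * (M / (1 - q))) 0) by (simpl; f_equal; ring).
    apply is_lim_seq_scal_l.
    apply (is_lim_seq_incr_1 (fun K => q ^ K)), is_lim_seq_geom.
    rewrite Rabs_pos_eq; lra. }
  (* The defect is [(c - P (S K)) + E (c - P K)]; each of the two terms is at most [q * t <= t]. *)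
  assert (Hfin : forall K, Rabs (c n + Series (fun j => E n j * c j) - alpha n)
      <= 2 * (M / (1 - q)) * q ^ S K).
  { intros K; destruct (HP K) as [P1 P2].
    set (t := M / (1 - q) * q ^ S K).
    assert (Ht : 0 <= t) by (eapply Rle_trans; [apply Rabs_pos | apply (Hc K n)]).
    destruct (Hbd (fun j => c j - P K j) t n (Hc K)) as [D1 D2].
    destruct (Hbd c _ n Hcb) as [C1 _].
    assert (D3 : Series (fun j => E n j * (c j - P K j)) =
       Series (fun j => E n j * c j) - (alpha n - P (S K) n)).
    { rewrite <- P2, <- Series_minus by auto.
      apply Series_ext; intros j; ring. }
    rewrite D3 in D2.
    assert (D4 := Hc (S K) n).
    replace (M / (1 - q) * q ^ S (S K)) with (q * t) in D4 by (unfold t; simpl; ring).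
    replace (c n + Series (fun j => E n j * c j) - alpha n) with
      ((c n - P (S K) n) + (Series (fun j => E n j * c j) - (alpha n - P (S K) n))) by ring.
    eapply Rle_trans; [apply Rabs_triang|].
    replace (2 * (M / (1 - q)) * q ^ S K) with (2 * t) by (unfold t; ring).
    nra. }
  apply Rminus_diag_uniq, Rabs_eq_0, Rle_antisym; [|apply Rabs_pos].
  change (Rbar_le (Rabs (c n + Series (fun j => E n j * c j) - alpha n)) 0).
  eapply is_lim_seq_le; [apply Hfin | apply is_lim_seq_const | exact Hlim].
Qed.

(** This writes the diagonal part of the interpolation matrix as a series, to be added to the
    off-diagonal one. *)
Lemma Series_single (a : nat -> R) (n : nat) :
  is_series (fun j => if Nat.eq_dec n j then a j else 0) (a n).
Proof.
  assert (H : forall K, sum_n (fun j => if Nat.eq_dec n j then a j else 0) K =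
     if le_dec n K then a n else 0 :> R).
  { induction K.
    - rewrite sum_O; destruct (Nat.eq_dec n 0), (le_dec n 0); subst; auto; lia.
    - rewrite sum_Sn, IHK; change (@plus R_AbelianMonoid) with Rplus.
      destruct (le_dec n K), (Nat.eq_dec n (S K)), (le_dec n (S K)); subst;
        first [lia | apply Rplus_0_r | apply Rplus_0_l]. }
  unfold is_series.
  apply (filterlim_ext_loc (fun _ => a n)).
  - exists n; intros K HK; rewrite H; destruct (le_dec n K); [reflexivity | lia].
  - apply filterlim_const.
Qed.

(* The kernel [1 - rho^2] of two points of (-1, 1), rho their pseudohyperbolic distance. *)
Definition closeness (a b : R) : R := (1 - a ^ 2) * (1 - b ^ 2) / (1 - a * b) ^ 2.

Lemma closeness_diag (a : R) : 0 <= a < 1 -> closeness a a = 1.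
Proof. intros Ha; unfold closeness; field; nra. Qed.

Lemma closeness_sym (a b : R) : closeness a b = closeness b a.
Proof.
  unfold closeness; rewrite (Rmult_comm b a), (Rmult_comm (1 - b ^ 2)); reflexivity.
Qed.

Lemma closeness_ge_0 (a b : R) : 0 <= a < 1 -> 0 <= b < 1 -> 0 <= closeness a b.
Proof.
  intros Ha Hb; unfold closeness; apply Rmult_le_pos; [apply Rmult_le_pos; nra|].
  apply Rlt_le, Rinv_0_lt_compat, pow_lt; nra.
Qed.

(** Indices start at 0 here, hence the successors. The numerator 2 arises from
    [1 - rho^2 <= 2 (1 - rho)]. *)
Definition well_separated (x : nat -> R) : Prop :=
  (forall j, 0 <= x j < 1) /\
  forall n j, n <> j -> closeness (x n) (x j) <= 2 / (INR (S n) * INR (S j)) ^ 4.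

Lemma closeness_system_solvable_real (x alpha : nat -> R) (M : R) :
  well_separated x -> (forall n, Rabs (alpha n) <= M) ->
  exists c : nat -> R, (exists M', forall n, Rabs (c n) <= M') /\
    forall n, Series (fun j => c j * closeness (x j) (x n)) = alpha n.
Proof.
  intros [Hx Hsep] HM.
  set (E := fun n j => if Nat.eq_dec n j then 0 else closeness (x j) (x n)).
  (* A bound on column [j], uniform in the row, which telescopes to the total 5/8. *)
  set (e := fun j => match j with
     | O => 1 / 8 | S i => 1 / 2 * (/ INR (S i) - / INR (S (S i))) end).
  assert (He0 : forall j, 0 <= e j).
  { intros [|i]; unfold e; [lra|].
    assert (P : 0 < INR (S i)) by (apply lt_0_INR; lia).
    assert (Q : / INR (S (S i)) <= / INR (S i))
      by (apply Rinv_le_contravar; auto; apply le_INR; lia).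
    lra. }
  assert (HE : forall n j, Rabs (E n j) <= e j).
  { intros n j; unfold E; destruct (Nat.eq_dec n j) as [->|Hnj].
    - rewrite Rabs_R0; auto.
    - rewrite Rabs_pos_eq by (apply closeness_ge_0; apply Hx).
      eapply Rle_trans; [apply Hsep; auto|].
      destruct j as [|i]; unfold e.
      (* In column 0 an off-diagonal row has [S n >= 2], which gives [2 / 2^4 = 1 / 8]. *)
      + destruct n as [|n]; [congruence|].
        assert (P : 2 <= INR (S (S n))) by (apply (le_INR 2); lia).
        simpl (INR 1); rewrite Rmult_1_l.
        assert (Q : 16 <= INR (S (S n)) ^ 4).
        { replace 16 with (2 ^ 4) by ring; apply pow_incr; lra. }
        apply Rle_trans with (2 / 16); [|lra].
        apply Rmult_le_compat_l; [lra|]; apply Rinv_le_contravar; lra.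
      (* With [s = i + 1] the entry is at most [2 / (s + 1)^4], and [(s + 1)^4 >= 4 s (s + 1)]. *)
      + assert (P : 1 <= INR (S i)) by (apply (le_INR 1); lia).
        assert (P' : 1 <= INR (S n)) by (apply (le_INR 1); lia).
        rewrite (S_INR (S i)); set (s := INR (S i)) in *.
        replace (1 / 2 * (/ s - / (s + 1))) with (2 / (4 * s * (s + 1))) by (field; lra).
        apply Rmult_le_compat_l; [lra|]; apply Rinv_le_contravar; [nra|].
        apply Rle_trans with ((s + 1) ^ 4).
        * assert (4 <= (s + 1) ^ 2) by nra.
          replace ((s + 1) ^ 4) with ((s + 1) ^ 2 * (s + 1) ^ 2) by ring; nra.
        * apply pow_incr; nra. }
  assert (Hsum : forall N, sum_n e N <= 5 / 8).
  { assert (Hs : forall N, sum_n e N = 5 / 8 - 1 / 2 * / INR (S N) :> R).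
    { induction N.
      - rewrite sum_O; simpl; field.
      - rewrite sum_Sn, IHN; change (@plus R_AbelianMonoid) with Rplus; unfold e; ring. }
    intros N; rewrite Hs.
    assert (P : 0 < / INR (S N)) by (apply Rinv_0_lt_compat, lt_0_INR; lia); lra. }
  destruct (ex_series_pos_bounded e (5 / 8) He0 Hsum) as [Hex Hle].
  destruct (neumann_bounded_inverse E e alpha (5 / 8) M) as [c [[M' Hc] Hn]]; auto; [lra|].
  exists c; split; [exists M'; auto|].
  intros n; rewrite <- Hn.
  assert (D := Series_single c n).
  assert (X : ex_series (fun j => E n j * c j)).
  { apply ex_series_Rabs_le with (fun j => M' * e j).
    - intros j; rewrite Rabs_mult, Rmult_comm; apply Rmult_le_compat; auto using Rabs_pos.
    - exact (ex_series_scal_l M' _ Hex). }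
  rewrite <- (is_series_unique _ _ D), <- Series_plus; auto.
  2:{ eexists; exact D. }
  apply Series_ext; intros j; unfold E; destruct (Nat.eq_dec n j) as [->|_]; [|ring].
  rewrite closeness_diag by apply Hx; ring.
Qed.

(** * Uniform bound for the sum of the bumps on the disc *)

Lemma sum_n_le_of_pairwise_min (m b : nat -> R) : 0 <= b 0%nat ->
  (forall j n, (j < n)%nat -> Rmin (m j) (m n) <= b n) ->
  forall N, exists p, (p <= N)%nat /\ sum_n m N <= m p + sum_n b N.
Proof.
  intros Hb H; induction N.
  - exists 0%nat; split; [lia|]; rewrite !sum_O; lra.
  - destruct IHN as [p [Hp HS]].
    rewrite !sum_Sn; change (@plus R_AbelianMonoid) with Rplus.
    (* [p] is the peak kept apart so far. Of [m p] and [m (S N)], the larger becomes the new peak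
       and the smaller is absorbed by [b (S N)]. *)
    assert (Hmin := H p (S N) ltac:(lia)).
    destruct (Rle_dec (m p) (m (S N))) as [L|L].
    + rewrite Rmin_left in Hmin by auto; exists (S N); split; [lia | lra].
    + rewrite Rmin_right in Hmin by lra; exists p; split; [lia | lra].
Qed.

(* [bump a z = 1 - phi(z)^2] for the disc automorphism [phi(z) = (z - a) / (1 - a z)]. *)
Definition bump (a : R) (z : C) : C :=
  ((1 - RtoC a ^ 2) * (1 - z ^ 2) / (1 - a * z) ^ 2)%C.

Lemma bump_RtoC (a b : R) : 0 <= a < 1 -> 0 <= b < 1 ->
  bump a (RtoC b) = RtoC (closeness a b).
Proof.
  intros Ha Hb; unfold bump, closeness.
  assert (H : (1 - a * b) ^ 2 <> 0) by (apply pow_nonzero; nra).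
  rewrite RtoC_div by auto.
  rewrite RtoC_mult, RtoC_pow, !RtoC_minus, RtoC_mult, <- !RtoC_pow; reflexivity.
Qed.

(** Put [d = 1 - a] and [t = |1 - z|]. The numerator is at most [2 d * 2 t]; [|1 - a z|] is at least
    [d] and at least [t - d], hence at least [(d + t) / 3]. This gives [36 = 2 * 2 * 9]. *)
Lemma Cmod_bump_le (a : R) (z : C) : 0 <= a < 1 -> Cmod z < 1 ->
  Cmod (bump a z) <= 36 * ((1 - a) * Cmod (1 - z) / (1 - a + Cmod (1 - z)) ^ 2).
Proof.
  intros Ha Hz; unfold bump.
  assert (Hz0 := Cmod_ge_0 z).
  assert (Ht : 0 < Cmod (1 - z)).
  { assert (H := Cmod_sub_ge 1 z); rewrite Cmod_1 in H; lra. }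
  assert (Hp : 1 - Cmod z * a <= Cmod (1 - a * z)).
  { eapply Rle_trans; [|apply Cmod_sub_ge].
    rewrite Cmod_1, Cmod_mult, Cmod_R, Rabs_pos_eq by lra; lra. }
  assert (Hpd : 1 - a <= Cmod (1 - a * z)) by nra.
  assert (Hpt : Cmod (1 - z) <= Cmod (1 - a * z) + (1 - a)).
  { replace (1 - z)%C with ((1 - a * z) - (RtoC (1 - a)) * z)%C
      by (rewrite RtoC_minus; ring).
    eapply Rle_trans; [apply Cmod_sub_le|].
    rewrite (Cmod_mult (RtoC _)), Cmod_R, Rabs_pos_eq by lra; nra. }
  assert (Hnz : (1 - a * z)%C <> 0) by (apply Cmod_gt_0; lra).
  rewrite Cmod_div by (apply Cpow_nz; auto).
  rewrite Cmod_mult, Cmod_pow.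
  assert (N1 : Cmod (1 - RtoC a ^ 2) <= 2 * (1 - a)).
  { rewrite <- RtoC_pow, <- RtoC_minus, Cmod_R, Rabs_pos_eq by nra; nra. }
  assert (N2 : Cmod (1 - z ^ 2) <= 2 * Cmod (1 - z)).
  { replace (1 - z ^ 2)%C with ((1 + z) * (1 - z))%C by ring.
    rewrite Cmod_mult; apply Rmult_le_compat_r; [lra|].
    eapply Rle_trans; [apply Cmod_triangle|]; rewrite Cmod_1; lra. }
  set (t := Cmod (1 - z)) in *; set (p := Cmod (1 - a * z)) in *.
  assert (N3 : / p ^ 2 <= 9 * / (1 - a + t) ^ 2).
  { replace (9 * / (1 - a + t) ^ 2) with (/ ((1 - a + t) / 3) ^ 2) by (field; lra).
    apply Rinv_le_contravar; [apply pow_lt; lra | apply pow_incr; lra]. }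
  replace (36 * ((1 - a) * t / (1 - a + t) ^ 2))
    with ((2 * (1 - a)) * (2 * t) * (9 * / (1 - a + t) ^ 2)) by (field; lra).
  unfold Rdiv; apply Rmult_le_compat; auto.
  - apply Rmult_le_pos; apply Cmod_ge_0.
  - apply Rlt_le, Rinv_0_lt_compat, pow_lt; lra.
  - apply Rmult_le_compat; auto using Cmod_ge_0.
Qed.

(* With [d = 1 - a] and [d' = 1 - b], this comes from [(d + t) (d' + t) >= t (d + d')]. *)
Lemma peak_mult_le_closeness (a b t : R) : 0 <= a < 1 -> 0 <= b < 1 -> 0 < t ->
  ((1 - a) * t / (1 - a + t) ^ 2) * ((1 - b) * t / (1 - b + t) ^ 2) <= closeness a b.
Proof.
  intros Ha Hb Ht; unfold closeness.
  set (d := 1 - a); set (d' := 1 - b).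
  assert (Hd : 0 < d) by (unfold d; lra); assert (Hd' : 0 < d') by (unfold d'; lra).
  apply Rle_trans with (d * d' * / (d + d') ^ 2).
  - replace (d * t / (d + t) ^ 2 * (d' * t / (d' + t) ^ 2))
      with (d * d' * / ((d + t) * (d' + t) / t) ^ 2) by (field; lra).
    apply Rmult_le_compat_l; [nra|].
    apply Rinv_le_contravar; [apply pow_lt; lra | apply pow_incr; split; [lra|]].
    apply Rmult_le_reg_r with t; auto.
    replace ((d + t) * (d' + t) / t * t) with ((d + t) * (d' + t)) by (field; lra); nra.
  (* Here [1 - a^2 >= d], [1 - b^2 >= d'] and [1 - a b = d + d' - d d' <= d + d']. *)
  - unfold Rdiv; apply Rmult_le_compat; [nra | | |].
    + apply Rlt_le, Rinv_0_lt_compat, pow_lt; lra.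
    + apply Rmult_le_compat; unfold d, d' in *; nra.
    + apply Rinv_le_contravar; [apply pow_lt; nra|].
      apply pow_incr; unfold d, d'; nra.
Qed.

(** The induction runs on the sharper bound [4 - 2 / (N + 1)], since [2 / (s + 1)^2] is at most the
    telescoping [2 / s - 2 / (s + 1)]. *)
Lemma sum_inv_square_le (N : nat) : sum_n (fun j => 2 / INR (S j) ^ 2) N <= 4.
Proof.
  assert (H : sum_n (fun j => 2 / INR (S j) ^ 2) N <= 4 - 2 / INR (S N)).
  { induction N.
    - rewrite sum_O; simpl; lra.
    - rewrite sum_Sn; change (@plus R_AbelianMonoid) with Rplus.
      assert (P : 1 <= INR (S N)) by (apply (le_INR 1); lia).
      rewrite (S_INR (S N)) in *; set (s := INR (S N)) in *.
      assert (Q : 2 / (s + 1) ^ 2 <= 2 / s - 2 / (s + 1)).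
      { replace (2 / s - 2 / (s + 1)) with (2 / (s * (s + 1))) by (field; lra).
        apply Rmult_le_compat_l; [lra|]; apply Rinv_le_contravar; nra. }
      lra. }
  assert (P : 0 < 2 / INR (S N)) by (apply Rdiv_lt_0_compat; [lra | apply lt_0_INR; lia]).
  lra.
Qed.

(** The constant is [36 * (1 + 4)]: one peak [m p <= 1], and at most 4 for the sum of all the
    others, because the smaller of two peaks is at most the square root of their product. *)
Lemma sum_bump_bounded (x : nat -> R) (z : C) : well_separated x -> Cmod z < 1 ->
  ex_series (fun j => Cmod (bump (x j) z)) /\ Series (fun j => Cmod (bump (x j) z)) <= 180.
Proof.
  intros [Hx Hsep] Hz.
  apply ex_series_pos_bounded; [intros; apply Cmod_ge_0|].
  set (t := Cmod (1 - z)).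
  assert (Ht : 0 < t).
  { assert (H := Cmod_sub_ge 1 z); rewrite Cmod_1 in H; unfold t; lra. }
  set (m := fun j => (1 - x j) * t / (1 - x j + t) ^ 2).
  assert (Hm : forall j, 0 <= m j <= 1).
  { intros j; specialize (Hx j); unfold m.
    assert (P : 0 < (1 - x j + t) ^ 2) by (apply pow_lt; lra).
    split.
    - apply Rmult_le_pos; [nra | apply Rlt_le, Rinv_0_lt_compat; auto].
    - apply Rmult_le_reg_r with ((1 - x j + t) ^ 2); auto.
      unfold Rdiv; rewrite Rmult_assoc, Rinv_l; nra. }
  assert (Hmin : forall j n, (j < n)%nat -> Rmin (m j) (m n) <= 2 / INR (S n) ^ 2).
  { intros j n Hjn.
    assert (L1 := Rmin_l (m j) (m n)); assert (L2 := Rmin_r (m j) (m n)).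
    assert (L0 : 0 <= Rmin (m j) (m n)) by (apply Rmin_glb; apply Hm).
    set (u := Rmin (m j) (m n)) in *.
    assert (Hmm : m j * m n <= 2 / INR (S n) ^ 4).
    { eapply Rle_trans; [apply peak_mult_le_closeness; auto|].
      eapply Rle_trans; [apply Hsep; lia|].
      assert (P : 1 <= INR (S n)) by (apply (le_INR 1); lia).
      assert (P' : 1 <= INR (S j)) by (apply (le_INR 1); lia).
      apply Rmult_le_compat_l; [lra|]; apply Rinv_le_contravar; [apply pow_lt; lra|].
      apply pow_incr; nra. }
    assert (P : 0 < INR (S n)) by (apply lt_0_INR; lia).
    set (s := INR (S n)) in *.
    assert (V0 : 0 < 2 / s ^ 2) by (apply Rdiv_lt_0_compat; [lra | apply pow_lt; auto]).
    assert (V : 2 / s ^ 4 <= (2 / s ^ 2) ^ 2).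
    { replace ((2 / s ^ 2) ^ 2) with (4 / s ^ 4) by (field; lra).
      apply Rmult_le_compat_r; [|lra]; apply Rlt_le, Rinv_0_lt_compat, pow_lt; auto. }
    assert (U : u * u <= m j * m n) by (apply Rmult_le_compat; auto).
    nra. }
  intros N.
  destruct (sum_n_le_of_pairwise_min m (fun j => 2 / INR (S j) ^ 2)) with (N := N)
    as [p [_ Hp]]; auto; [simpl; lra|].
  assert (B := sum_inv_square_le N); assert (Hmp := Hm p).
  apply Rle_trans with (36 * sum_n m N); [|lra].
  assert (L : forall N, sum_n (fun j => Cmod (bump (x j) z)) N <= 36 * sum_n m N).
  { induction N0.
    - rewrite !sum_O; apply Cmod_bump_le; auto.
    - rewrite !sum_Sn; change (@plus R_AbelianMonoid) with Rplus.
      rewrite Rmult_plus_distr_l.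
      apply Rplus_le_compat; [exact IHN0 | apply Cmod_bump_le; auto]. }
  apply L.
Qed.

(** * Bounded interpolation on the disc *)

Lemma Csummable_weights (x : nat -> R) (c : nat -> C) (M : R) :
  well_separated x -> (forall j, Cmod (c j) <= M) ->
  Csummable (fun j => c j * (1 - RtoC (x j) ^ 2))%C.
Proof.
  intros Hx HM.
  (* At [z = 0] the bumps are exactly the weights [1 - x_j^2]. *)
  destruct (sum_bump_bounded x 0 Hx) as [H _]; [rewrite Cmod_0; lra|].
  apply Csummable_le with (fun j => M * Cmod (bump (x j) 0)).
  - intros j; rewrite Cmod_mult.
    replace (bump (x j) 0) with (1 - RtoC (x j) ^ 2)%C
      by (unfold bump; field).
    apply Rmult_le_compat_r; auto using Cmod_ge_0.
  - exact (ex_series_scal_l M _ H).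
Qed.

(** The left side is suited to analyticity and power series, the right side to boundedness and to
    the values at the [x n]. *)
Lemma bump_sum_eq (x : nat -> R) (c : nat -> C) (M : R) (z : C) :
  well_separated x -> (forall j, Cmod (c j) <= M) -> Cmod z < 1 ->
  ((1 - z ^ 2) * kernel_sum (fun j => c j * (1 - RtoC (x j) ^ 2)) x z)%C =
  CSeries (fun j => c j * bump (x j) z)%C.
Proof.
  intros Hx HM Hz; unfold kernel_sum.
  rewrite <- CSeries_scal.
  - apply CSeries_ext; intros j; unfold bump, Cdiv; ring.
  - apply Csummable_mult_bounded with (/ (1 - Cmod z) ^ 2).
    + intros j.
      assert (G : 1 - Cmod z <= Cmod (1 - x j * z))
        by (apply Cmod_one_minus_ge; destruct Hx as [Hx _]; specialize (Hx j); lra).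
      rewrite Cmod_inv by (apply Cpow_nz, Cmod_gt_0; lra).
      rewrite Cmod_pow; apply Rinv_le_contravar; [apply pow_lt; lra | apply pow_incr; lra].
    + apply Csummable_weights with M; auto.
Qed.

(** This is what multiplication by [z^2] does to the coefficients of a power series. *)
Lemma C_series_shift2 (a : nat -> C) (l : C) :
  @is_series C_AbsRing C_NormedModule a l ->
  @is_series C_AbsRing C_NormedModule
    (fun k => match k with S (S k') => a k' | _ => RtoC 0 end) l.
Proof.
  intros H.
  assert (E : forall l : C, @plus C_NormedModule l (opp (RtoC 0)) = l)
    by (intros; change (l0 + - (RtoC 0) = l0)%C; ring).
  apply is_series_decr_1; rewrite E.
  apply is_series_decr_1; rewrite E; exact H.
Qed.

Lemma disc_interpolation (x : nat -> R) (alpha : nat -> C) (M : R) :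
  well_separated x -> (forall n, Cmod (alpha n) <= M) ->
  exists g : C -> C,
    (forall z, Cmod z < 1 -> exists l,
       @is_derive C_AbsRing (AbsRing_NormedModule C_AbsRing) g z l) /\
    (exists B, forall z, Cmod z < 1 -> Cmod (g z) <= B) /\
    (exists b : nat -> C, forall z, Cmod z < 1 ->
       @is_series C_AbsRing C_NormedModule (fun k => b k * z ^ k)%C (g z)) /\
    (forall n, g (RtoC (x n)) = alpha n).
Proof.
  intros Hx HM.
  (* The matrix is real, so the real and imaginary parts of the data are interpolated separately. *)
  destruct (closeness_system_solvable_real x (fun n => Re (alpha n)) M Hx) as [c1 [[M1 HM1] H1]].
  { intros n; eapply Rle_trans; [apply re_le_Cmod | apply HM]. }
  destruct (closeness_system_solvable_real x (fun n => Im (alpha n)) M Hx) as [c2 [[M2 HM2] H2]].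
  { intros n; eapply Rle_trans; [apply im_le_Cmod | apply HM]. }
  set (c := fun n => (c1 n, c2 n) : C).
  assert (Hc : forall n, Cmod (c n) <= M1 + M2).
  { intros n; eapply Rle_trans; [apply Cmod_le_Re_Im|].
    apply Rplus_le_compat; [apply HM1 | apply HM2]. }
  set (w := fun j => (c j * (1 - RtoC (x j) ^ 2))%C).
  assert (Hw : Csummable w) by (apply Csummable_weights with (M1 + M2); auto).
  assert (Hx1 : forall j, 0 <= x j <= 1) by (intros j; destruct Hx as [Hx _]; specialize (Hx j); lra).
  exists (fun z => (1 - z ^ 2) * kernel_sum w x z)%C; repeat split.
  - intros z Hz; eexists.
    apply (is_derive_mult (K := C_AbsRing) (fun z => 1 - z ^ 2)%C (kernel_sum w x) z).
    + apply (is_C_derive_quadratic _ z (- (2 * z))%C 1 1); [lra|].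
      intros y _.
      replace (1 - y ^ 2 - (1 - z ^ 2) - (y - z) * - (2 * z))%C
        with (- (y - z) ^ 2)%C by ring.
      rewrite Cmod_opp, Cmod_pow; lra.
    + apply is_C_derive_kernel_sum; auto.
    + exact Cmult_comm.
  - exists (2 * ((M1 + M2) * 180)); intros z Hz.
    unfold w; rewrite (bump_sum_eq x c (M1 + M2)) by auto.
    destruct (sum_bump_bounded x z Hx Hz) as [S1 S2].
    apply Rle_trans with (2 * Series (fun j => (M1 + M2) * Cmod (bump (x j) z))).
    + apply Cmod_CSeries_le.
      * intros j; rewrite Cmod_mult; apply Rmult_le_compat_r; auto using Cmod_ge_0.
      * exact (ex_series_scal_l (M1 + M2) _ S1).
    + apply Rmult_le_compat_l; [lra|]; rewrite Series_scal_l.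
      apply Rmult_le_compat_l; auto.
      eapply Rle_trans; [apply Cmod_ge_0 | apply (Hc 0%nat)].
  - set (a := fun k => (RtoC (INR (S k)) * CSeries (fun j => w j * RtoC (x j) ^ k))%C).
    (* The coefficients of [(1 - z^2) * sum_k a_k z^k]. *)
    exists (fun k => a k - match k with S (S k') => a k' | _ => 0 end)%C.
    intros z Hz.
    assert (S0 := kernel_sum_power_series w x z Hw Hx1 Hz).
    assert (S1 := C_series_shift2 _ _ (is_series_scal (z ^ 2)%C _ _ S0)).
    assert (S2 := is_series_minus _ _ _ _ S0 S1).
    replace ((1 - z ^ 2) * kernel_sum w x z)%C with
      (kernel_sum w x z + - (z ^ 2 * kernel_sum w x z))%C by ring.
    eapply is_series_ext; [|exact S2].
    intros k.
    change (@plus C_NormedModule) with Cplus; change (@opp C_NormedModule) with Copp.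
    change (@scal C_AbsRing C_NormedModule) with Cmult.
    match goal with |- ?l = ?r => change (@eq C l r) end.
    unfold a; destruct k as [|[|k]]; [ring | ring |].
    rewrite (Cpow_S z (S k)), (Cpow_S z k); ring.
  - intros n.
    assert (Hn : Cmod (RtoC (x n)) < 1).
    { destruct Hx as [Hx _]; specialize (Hx n); rewrite Cmod_R, Rabs_pos_eq; lra. }
    unfold w; rewrite (bump_sum_eq x c (M1 + M2)) by auto.
    destruct Hx as [Hx _].
    assert (E : forall j, (c j * bump (x j) (RtoC (x n)))%C =
      (c1 j * closeness (x j) (x n), c2 j * closeness (x j) (x n)) :> C).
    { intros j; rewrite bump_RtoC by auto; apply injective_projections; simpl; ring. }
    rewrite (CSeries_ext _ _ E); cbv [CSeries Re Im fst snd].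
    rewrite H1, H2; destruct (alpha n); reflexivity.
Qed.

(** * From power series on the disc to Dirichlet series on the half-plane *)

Lemma Cexp_INR_mult (s : C) (k : nat) : Cexp (RtoC (INR k) * s) = (Cexp s ^ k)%C.
Proof.
  induction k.
  - replace (RtoC (INR 0) * s)%C with (RtoC 0) by (simpl; ring).
    unfold Cexp; simpl; rewrite exp_0, cos_0, sin_0.
    apply injective_projections; simpl; ring.
  - rewrite S_INR, RtoC_plus, Cpow_S, <- IHk, <- Cexp_plus; f_equal; ring.
Qed.

Lemma npow_neg_pow2 (k : nat) (s : C) : npow_neg (2 ^ k) s = (npow_neg 2 s ^ k)%C.
Proof.
  unfold npow_neg; rewrite <- Cexp_INR_mult, pow_INR, ln_pow by (simpl; lra).
  rewrite RtoC_mult; f_equal; ring.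
Qed.

Lemma Cmod_npow_neg_2 (s : C) : 0 < Re s -> Cmod (npow_neg 2 s) < 1.
Proof.
  intros Hs; unfold npow_neg; rewrite Cmod_Cexp, <- exp_0; apply exp_increasing.
  replace (INR 2) with 2 by (simpl; ring).
  assert (H := ln_lt_2); destruct s as [a b]; simpl in *; nra.
Qed.

Lemma is_C_derive_npow_neg_2 (s : C) : exists l,
  @is_derive C_AbsRing (AbsRing_NormedModule C_AbsRing) (npow_neg 2) s l.
Proof.
  eexists; unfold npow_neg.
  apply (is_derive_comp (K := C_AbsRing) (V := AbsRing_NormedModule C_AbsRing)
    Cexp (fun s => - s * RtoC (ln (INR 2)))%C).
  - apply is_C_derive_Cexp.
  - apply (is_C_derive_quadratic _ s (- RtoC (ln (INR 2)))%C 1 0); [lra|].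
    intros y _.
    match goal with |- Cmod ?e <= _ => replace e with (RtoC 0) by ring end.
    rewrite Cmod_0; lra.
Qed.

(** Dirichlet coefficients carried by the powers of 2, which are the [n >= 1] fixed by
    [n |-> 2 ^ Nat.log2 n]. *)
Definition lacunary (b : nat -> C) (n : nat) : C :=
  if Nat.eqb (2 ^ Nat.log2 n) n then b (Nat.log2 n) else 0.

(** In passing from [S N] to [S (S N)], [Nat.log2] increases exactly when a power of 2 is reached,
    that is, when a new nonzero coefficient can occur. *)
Lemma sum_lacunary (b : nat -> C) (s : C) (N : nat) :
  sum_n (G := C_NormedModule) (fun n => lacunary b (S n) * npow_neg (S n) s)%C N =
  sum_n (G := C_NormedModule) (fun k => b k * npow_neg 2 s ^ k)%C (Nat.log2 (S N)).
Proof.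
  induction N.
  - rewrite sum_O; change (Nat.log2 1) with 0%nat; rewrite sum_O.
    rewrite <- npow_neg_pow2; reflexivity.
  - rewrite sum_Sn, IHN; set (l := Nat.log2 (S N)).
    assert (Hl := Nat.log2_spec (S N) ltac:(lia)); fold l in Hl.
    unfold lacunary.
    destruct (Nat.log2_succ_or (S N)) as [E|E]; rewrite E; fold l.
    + assert (Hl' := Nat.log2_spec (S (S N)) ltac:(lia)); rewrite E in Hl'; fold l in Hl'.
      assert (P : (2 ^ S l)%nat = S (S N)) by lia.
      rewrite P, Nat.eqb_refl, sum_Sn, <- npow_neg_pow2, P; reflexivity.
    + destruct (Nat.eqb_spec (2 ^ l) (S (S N))); [lia|].
      match goal with |- plus ?u ?v = _ => change (u + v = u)%C end; ring.
Qed.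

(** The Dirichlet partial sums are those of the power series at index [Nat.log2 (S N)], which tends
    to infinity. *)
Lemma is_series_lacunary (b : nat -> C) (s l : C) :
  @is_series C_AbsRing C_NormedModule (fun k => b k * npow_neg 2 s ^ k)%C l ->
  @is_series C_AbsRing C_NormedModule (fun n => lacunary b (S n) * npow_neg (S n) s)%C l.
Proof.
  unfold is_series; intros H.
  eapply filterlim_ext; [intros N; symmetry; apply sum_lacunary|].
  apply (filterlim_comp _ _ _ (fun N => Nat.log2 (S N)) _ _ eventually); [|exact H].
  intros P [m Hm]; exists (2 ^ m)%nat; intros n Hn; apply Hm.
  rewrite <- (Nat.log2_pow2 m) by lia; apply Nat.log2_le_mono; lia.
Qed.

Lemma in_Hinfty_comp_npow_neg_2 (g : C -> C) :
  (forall z, Cmod z < 1 -> exists l,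
     @is_derive C_AbsRing (AbsRing_NormedModule C_AbsRing) g z l) ->
  (exists B, forall z, Cmod z < 1 -> Cmod (g z) <= B) ->
  (exists b : nat -> C, forall z, Cmod z < 1 ->
     @is_series C_AbsRing C_NormedModule (fun k => b k * z ^ k)%C (g z)) ->
  in_Hinfty (fun s => g (npow_neg 2 s)).
Proof.
  intros Hd [B HB] [b Hb]; split; [|split].
  - intros s Hs.
    destruct (Hd _ (Cmod_npow_neg_2 s Hs)) as [l Hl].
    destruct (is_C_derive_npow_neg_2 s) as [l' Hl'].
    eexists; apply (is_derive_comp (K := C_AbsRing) (V := C_NormedModule)); [|exact Hl'].
    apply is_C_derive_NormedModule; exact Hl.
  - exists B; intros s Hs; apply HB, Cmod_npow_neg_2, Hs.
  - exists (lacunary b), 0; intros s Hs _.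
    apply is_series_lacunary, Hb, Cmod_npow_neg_2, Hs.
Qed.

(** * Separation and existence of admissible sequences *)

Lemma rho_D_RtoC (a b : R) : 0 <= a < 1 -> 0 <= b < 1 ->
  rho_D (RtoC a) (RtoC b) = Rabs (a - b) / (1 - a * b).
Proof.
  intros Ha Hb; unfold rho_D.
  replace (Cconj (RtoC a)) with (RtoC a)
    by (apply injective_projections; simpl; ring).
  assert (P : 0 < 1 - a * b) by nra.
  rewrite <- RtoC_mult, <- !RtoC_minus, Cmod_div, !Cmod_R.
  - rewrite (Rabs_pos_eq (1 - a * b)) by lra; reflexivity.
  - intros E; apply RtoC_inj in E; lra.
Qed.

(** For [r] the distance, [closeness a b = 1 - r^2]. Its nonnegativity gives [r <= 1], hence
    [1 - r^2 <= 2 (1 - r)]. *)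
Lemma closeness_le_of_rho_D (a b delta : R) : 0 <= a < 1 -> 0 <= b < 1 ->
  rho_D (RtoC a) (RtoC b) >= 1 - delta -> closeness a b <= 2 * delta.
Proof.
  intros Ha Hb H; rewrite rho_D_RtoC in H by auto.
  assert (P : 0 < 1 - a * b) by nra.
  set (r := Rabs (a - b) / (1 - a * b)) in *.
  assert (E : closeness a b = 1 - r * r).
  { unfold closeness, r.
    replace (Rabs (a - b) / (1 - a * b) * (Rabs (a - b) / (1 - a * b)))
      with (Rabs (a - b) * Rabs (a - b) / (1 - a * b) ^ 2) by (field; lra).
    rewrite <- Rabs_mult, Rabs_pos_eq by apply Rle_0_sqr; field; lra. }
  assert (H0 : 0 <= r)
    by (apply Rmult_le_pos; [apply Rabs_pos | apply Rlt_le, Rinv_0_lt_compat; auto]).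
  assert (H1 := closeness_ge_0 a b Ha Hb); nra.
Qed.

(** The distance equals [(d - d') / (d + d' - d d')], which is at least
    [(d - d') / (d + d') >= 1 - 2 d' / d]. *)
Lemma rho_D_ge_of_ratio (d d' delta : R) : 0 < d' <= 1 -> 0 < d <= 1 -> 0 <= delta <= 1 ->
  2 * d' <= delta * d ->
  rho_D (RtoC (1 - d')) (RtoC (1 - d)) >= 1 - delta.
Proof.
  intros Hd' Hd Hdelta H; rewrite rho_D_RtoC by lra.
  assert (P : 0 < 1 - (1 - d') * (1 - d)) by nra.
  rewrite Rabs_pos_eq by nra.
  apply Rle_ge, Rmult_le_reg_r with (1 - (1 - d') * (1 - d)); auto.
  replace ((1 - d' - (1 - d)) / (1 - (1 - d') * (1 - d)) * (1 - (1 - d') * (1 - d)))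
    with (d - d') by (field; lra).
  nra.
Qed.

Lemma Rpower_2_opp_bounds (s : R) : 0 < s -> 0 < Rpower 2 (- s) < 1.
Proof.
  intros Hs; unfold Rpower; split; [apply exp_pos|].
  rewrite <- exp_0; apply exp_increasing; assert (H := ln_lt_2); nra.
Qed.

Lemma Rpower_2_log (x : R) : 0 < x -> Rpower 2 (- (- ln x / ln 2)) = x.
Proof.
  intros Hx; assert (H := ln_lt_2); unfold Rpower.
  replace (- (- ln x / ln 2) * ln 2) with (ln x) by (field; lra).
  apply exp_ln; auto.
Qed.

(* The gaps [1 - x_n]; the exponent 8 is there because [(n k)^4 <= n^8] for [k < n]. *)
Fixpoint gap (d : R) (n : nat) : R :=
  match n with
  | O => d
  | S n' => gap d n' / (2 * INR (S (S n')) ^ 8)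
  end.

Lemma gap_denominator (n : nat) : 2 <= 2 * INR (S n) ^ 8.
Proof.
  assert (P : 1 <= INR (S n)) by (apply (le_INR 1); lia).
  assert (Q := pow_R1_Rle _ 8 P); lra.
Qed.

Lemma gap_bounds (d : R) (n : nat) : 0 < d < 1 -> 0 < gap d n < 1.
Proof.
  intros Hd; induction n; [exact Hd|].
  change (gap d (S n)) with (gap d n / (2 * INR (S (S n)) ^ 8)).
  assert (D := gap_denominator (S n)).
  split; [apply Rdiv_lt_0_compat; lra|].
  apply Rmult_lt_reg_r with (2 * INR (S (S n)) ^ 8); [lra|].
  unfold Rdiv; rewrite Rmult_assoc, Rinv_l by lra; lra.
Qed.

(** The step from [n - 1] to [n] supplies the whole factor; the earlier steps only have to decrease
    the gap. *)
Lemma gap_ratio (d : R) (k n : nat) : 0 < d < 1 -> (k < n)%nat ->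
  gap d n * (2 * INR (S n) ^ 8) <= gap d k.
Proof.
  intros Hd; induction n; intros Hkn; [lia|].
  assert (D := gap_denominator (S n)).
  replace (gap d (S n) * (2 * INR (S (S n)) ^ 8)) with (gap d n)
    by (change (gap d (S n)) with (gap d n / (2 * INR (S (S n)) ^ 8));
        unfold Rdiv; rewrite Rmult_assoc, Rinv_l; lra).
  destruct (Nat.eq_dec k n) as [->|Hne]; [lra|].
  specialize (IHn ltac:(lia)).
  assert (B := gap_bounds d n Hd); assert (D' := gap_denominator n); nra.
Qed.

Lemma admissible_exists (sigma1 : R) : 0 < sigma1 ->
  exists sigma : nat -> R, admissible sigma1 sigma.
Proof.
  intros Hs; assert (Hb := Rpower_2_opp_bounds _ Hs).
  set (d := 1 - Rpower 2 (- sigma1)).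
  assert (Hd : 0 < d < 1) by (unfold d; lra).
  assert (Hl := ln_lt_2).
  (* Chosen so that [2^(-sigma_n) = 1 - gap d (n - 1)]; [pred] matches the indexing from 1 with that
     of [gap] from 0. *)
  exists (fun n => - ln (1 - gap d (pred n)) / ln 2); split; [|split].
  - simpl; unfold d.
    replace (1 - (1 - Rpower 2 (- sigma1))) with (Rpower 2 (- sigma1)) by ring.
    unfold Rpower; rewrite ln_exp; field; lra.
  - intros n _; assert (B := gap_bounds d (pred n) Hd).
    apply Rdiv_lt_0_compat; [|lra].
    assert (L : ln (1 - gap d (pred n)) < ln 1) by (apply ln_increasing; lra).
    rewrite ln_1 in L; lra.
  - intros n k Hk Hkn.
    assert (Bn := gap_bounds d (pred n) Hd); assert (Bk := gap_bounds d (pred k) Hd).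
    rewrite !Rpower_2_log by lra.
    assert (R := gap_ratio d (pred k) (pred n) Hd ltac:(lia)).
    replace (S (pred n)) with n in R by lia.
    assert (Nk : 1 <= INR k) by (apply (le_INR 1); lia).
    assert (Nn : INR k <= INR n) by (apply le_INR; lia).
    assert (P : 1 <= (INR n * INR k) ^ 4) by (apply pow_R1_Rle; nra).
    assert (Q : (INR n * INR k) ^ 4 <= INR n ^ 8).
    { replace (INR n ^ 8) with ((INR n * INR n) ^ 4) by ring; apply pow_incr; nra. }
    set (q := (INR n * INR k) ^ 4) in *.
    apply rho_D_ge_of_ratio; [lra | lra | |].
    + split; [apply Rlt_le, Rdiv_lt_0_compat; lra|].
      apply Rmult_le_reg_r with q; [lra|]; unfold Rdiv; rewrite Rmult_assoc, Rinv_l; lra.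
    + apply Rmult_le_reg_r with q; [lra|].
      replace (1 / q * gap d (pred k) * q) with (gap d (pred k)) by (field; lra).
      nra.
Qed.

Lemma admissible_well_separated (sigma1 : R) (sigma : nat -> R) :
  admissible sigma1 sigma -> well_separated (fun j => Rpower 2 (- sigma (S j))).
Proof.
  intros [_ [Hpos Hrho]].
  assert (Hx : forall j, 0 <= Rpower 2 (- sigma (S j)) < 1).
  { intros j; destruct (Rpower_2_opp_bounds (sigma (S j))); [apply Hpos; lia | lra]. }
  split; auto.
  assert (H : forall n j, (j < n)%nat ->
    closeness (Rpower 2 (- sigma (S n))) (Rpower 2 (- sigma (S j)))
      <= 2 / (INR (S n) * INR (S j)) ^ 4).
  { intros n j Hjn.
    replace (2 / (INR (S n) * INR (S j)) ^ 4)
      with (2 * (1 / (INR (S n) * INR (S j)) ^ 4)) by (unfold Rdiv; ring).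
    apply closeness_le_of_rho_D; auto; apply Hrho; lia. }
  intros n j Hnj; destruct (Nat.lt_total n j) as [L|[L|L]]; [|lia|auto].
  rewrite closeness_sym, (Rmult_comm (INR (S n))); auto.
Qed.

(** The map [s |-> 2^(-s)] has period [2 pi i / log 2], so all the points land on the real axis. *)
Lemma npow_neg_2_vertical_period (sigma : R) (k : Z) :
  npow_neg 2 (RtoC sigma + Ci * RtoC (2 * PI * IZR k / ln 2)) = RtoC (Rpower 2 (- sigma)).
Proof.
  assert (Hl := ln_lt_2).
  unfold npow_neg, Cexp, Rpower; replace (INR 2) with 2 by (simpl; ring).
  assert (Hsin : sin (- IZR k * PI) = 0).
  { apply sin_eq_0_1; exists (- k)%Z; rewrite opp_IZR; reflexivity. }
  match goal with |- (exp ?a * cos ?b, exp ?a * sin ?b) = _ =>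
    replace a with (- sigma * ln 2) by (simpl; ring);
    (* As a double angle, both cos and sin are expressed through [sin (- IZR k * PI) = 0]. *)
    replace b with (2 * (- IZR k * PI)) by (simpl; field; lra) end.
  rewrite cos_2a_sin, sin_2a, Hsin; unfold RtoC; f_equal; ring.
Qed.

Theorem mainTheorem8 (k : nat -> Z) (sigma1 : R) (hsigma1 : 0 < sigma1) :
  (exists sigma : nat -> R, admissible sigma1 sigma) /\
  (forall sigma : nat -> R, admissible sigma1 sigma ->
     interpolating_Hinfty
       (fun n : nat =>
          (RtoC (sigma n) + Ci * RtoC (2 * PI * IZR (k n) / ln 2))%C)).
Proof.
  split; [apply admissible_exists; auto|].
  intros sigma Hadm; split.
  - intros n Hn; destruct Hadm as [_ [Hpos _]]; specialize (Hpos n Hn); simpl; lra.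
  - intros alpha [M HM].
    (* Points and data are shifted by one, since the disc result is indexed from 0. *)
    destruct (disc_interpolation (fun j => Rpower 2 (- sigma (S j)))
      (fun j => alpha (S j)) M) as [g [Hd [HB [Hser Hval]]]].
    + apply admissible_well_separated with sigma1; auto.
    + intros n; apply HM; lia.
    + exists (fun s => g (npow_neg 2 s)); split.
      * apply in_Hinfty_comp_npow_neg_2; auto.
      * intros [|n] Hn; [lia|].
        rewrite npow_neg_2_vertical_period; apply Hval.
Qed.
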